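(* Let $R$ be a unital ring and let $I\subseteq R$ be a two-sided ideal. Then the following are equivalent: (i) $I$ is quasipure. (ii) Given any finite subset $X\subseteq I$, there exist finitely generated left ideals $J_1\le J_2\le I$ of $R$ such that $X\subseteq J_1$ and $J_2J_1=J_1$. (iii) $I$ is the trace ideal of a projective right $R$-module.
   Context: $M_\infty(R)$ is the ring of infinite matrices over $R$ with finitely many nonzero entries. For $x,y\in M_\infty(R)$, $x\precsim_1 y$ means $x=syt$ for some $s,t\in M_\infty(R)$. A two-sided ideal $I$ of $R$ is quasipure if for every $x\in M_\infty(I)$ there are $s,y\in M_\infty(I)$ with $sy=y$ and $x\precsim_1 y$ in $M_\infty(R)$. The trace ideal of a projective right $R$-module $P$ is $\sum_f f(P)$, where $f$ ranges over all $R$-module homomorphisms $P\to R$. *)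

(* Defs.v *)
From HB Require Import structures.
From mathcomp Require Import all_boot all_algebra finmap.
From mathcomp Require Import classical_sets cardinality.

Set Implicit Arguments.
Unset Strict Implicit.
Unset Printing Implicit Defensive.

Import GRing.Theory.
Local Open Scope ring_scope.
Local Open Scope classical_set_scope.

(* Rings are [pzRingType]s: unital, associative, possibly zero.               *)

Section Ideals.
Variable R : pzRingType.

(* Closure under opposites follows from closure under multiplication by -1.   *)
Definition left_ideal (J : set R) : Prop :=
  [/\ J 0, (forall x y, J x -> J y -> J (x + y))
    & (forall a x, J x -> J (a * x))].

Definition two_sided_ideal (I : set R) : Prop :=
  left_ideal I /\ (forall x a, I x -> I (x * a)).

Definition fg_left_ideal (J : set R) : Prop :=
  exists2 X : set R, finite_set X & J = smallest left_ideal X.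

Definition ideal_mul (A B : set R) : set R :=
  [set z | exists n (a b : 'I_n -> R),
     [/\ (forall i, A (a i)), (forall i, B (b i))
       & z = \sum_(i < n) a i * b i]].

End Ideals.

Section InfiniteMatrices.
Variable R : pzRingType.

(* Rows and columns are indexed by [nat]; the (i, j) entry of x is x (i, j).  *)
Definition Minf : Type := {fsfun nat * nat -> R with 0}.

(* The sum over all j of x (i, j) * y (j, k), restricted to the support of x. *)
Definition mul_Minf (x y : Minf) : Minf :=
  [fsfun p in [fset (q.1, r.2) | q in finsupp x, r in finsupp y]%fset =>
     \sum_(q <- finsupp x | q.1 == p.1) x q * y (q.2, p.2)].

Definition Minf_in (I : set R) : set Minf :=
  [set x | forall i j, I (x (i, j))].

Definition precsim1 (x y : Minf) : Prop :=
  exists s t : Minf, x = mul_Minf (mul_Minf s y) t.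

Definition quasipure (I : set R) : Prop :=
  forall x, Minf_in I x ->
    exists s y, [/\ Minf_in I s, Minf_in I y, mul_Minf s y = y & precsim1 x y].

Lemma mul_MinfE (x y : Minf) (n i k : nat) :
    (forall j : nat, (n <= j)%N -> x (i, j) = 0) ->
  mul_Minf x y (i, k) = \sum_(j < n) x (i, j : nat) * y (j : nat, k).
Proof.
move=> x0.
have -> : mul_Minf x y (i, k) =
    \sum_(q <- finsupp x | q.1 == i) x q * y (q.2, k).
  rewrite fsfunE; case: ifPn => // /negP ikN.
  rewrite big_seq_cond big1 // => -[i' j] /= /andP[xq /eqP ii']; subst i'.
  case: (boolP ((j, k) \in finsupp y)) => [yr|/fsfun_dflt ->].
    by case: ikN; apply/imfset2P; exists (i, j) => //; exists (j, k).
  by rewrite mulr0.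
rewrite -(big_mkord xpredT (fun j => x (i, j) * y (j, k))).
rewrite [RHS](bigID (fun j => (i, j) \in finsupp x)) /= [X in _ + X]big1 ?addr0.
  rewrite -[RHS]big_filter -[LHS]big_filter.
  rewrite -(big_map (fun j => (i, j)) xpredT (fun q => x q * y (q.2, k))).
  apply: perm_big; apply: uniq_perm.
  - by rewrite filter_uniq// fset_uniq.
  - by rewrite map_inj_uniq ?filter_uniq ?iota_uniq// => ? ? [].
  move=> [i' j]; rewrite mem_filter /=; apply/andP/mapP => [[/eqP -> xq]|].
    exists j => //; rewrite mem_filter xq mem_index_iota /= ltnNge.
    by apply/negP => /x0 /eqP; apply/negP; rewrite mem_finsupp in xq.
  by move=> [j' + [-> ->]]; rewrite mem_filter => /andP[-> _].
by move=> j /fsfun_dflt ->; rewrite mul0r.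
Qed.

End InfiniteMatrices.

Definition projective (S : pzRingType) (P : lmodType S) : Prop :=
  forall (M N : lmodType S) (g : {linear M -> N}) (f : {linear P -> N}),
    (forall y, exists x, g x = y) ->
  exists h : {linear P -> M}, forall p, g (h p) = f p.

(* A right R-module is a left module over the converse ring [R^c]; the right  *)
(* R-module R is [R^c^o], on which a : R acts by x |-> x * a.                 *)
Definition trace_ideal (R : pzRingType) (P : lmodType R^c) : set R :=
  [set z | exists n (f : 'I_n -> {linear P -> R^c^o}) (p : 'I_n -> P),
     z = \sum_(i < n) (f i (p i) : R)].

(* Main.v *)
Require Import Defs.
From HB Require Import structures.
From mathcomp Require Import all_boot all_algebra finmap.
From mathcomp Require Import boolp classical_sets functions cardinality fsbigop.

Set Implicit Arguments.
Unset Strict Implicit.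
Unset Printing Implicit Defensive.

Import GRing.Theory.
Local Open Scope ring_scope.
Local Open Scope classical_set_scope.

(** The three conditions are proved equivalent in the cycle
    (i) => (iii) => (ii) => (i).

    (i) => (iii).  Start from x over I and iterate quasipurity: x = u_0 A_0 with
    s_0 A_0 = A_0, then s_0 = u_1 A_1 with s_1 A_1 = A_1, and so on, all the A_n
    and s_n over I.  Hence u_(n+1) A_(n+1) A_n = s_n A_n = A_n, that is, with
    T_n = u_(n+1), the tower A satisfies T_n A_(n+1) A_n = A_n
    ([quasipure_tower]).  The direct limit of the columns of R along such a tower
    is projective, because the T_n split the telescope that presents it.  That
    limit is realised as the module of sequences w of columns such that
    w_n = T_n w_(n+1) for all n and w_(n+1) = A_(n+1) w_n for all large n.  The
    defects w_0 and w_(n+1) - A_(n+1) w_n are the coordinates of a dual basis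
    ([tower_dual_basis]).  Every entry of w lies in I, as w_n is T_n ... T_(N-1)
    A_N w_(N-1) for N large; so linear forms take values in I
    ([tower_trace_sub]).  Conversely the entries of A_0 are values of linear
    forms, and therefore so are those of x = u_0 A_0 ([sub_tower_trace]).
    Carrying all x at once, that is, taking the direct sum of the limits over
    all x, produces all of I.

    (iii) => (ii).  Let e_q, phi_q be a dual basis of P.  Any f(p) is
    the sum of the f(e_q) phi_q(p), so a finite X is in the left ideal J1 generated
    by the phi_q(p), p in a finite set.  As phi_q(p) is the sum of the
    phi_q(e_r) phi_r(p), the left ideal J2 generated by the phi_q(p) and finitely
    many phi_q(e_r) satisfies J2 J1 = J1 ([trace_ideal_chain]).

    (ii) => (i).  A finite generating set b of J1, seen as a column, satisfies
    b = s b with s over I, since J2 R is contained in I.  Each entry of x is a left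
    combination of b, so x is a left multiple of the block diagonal matrix with
    one copy of b for each column of x, and this matrix is reproduced by the
    block diagonal matrix with diagonal blocks s ([quasipure_of_chain]). *)

(** * Submodules, dual bases and projectivity *)

Section Submodule.
Variables (K : pzRingType) (V : lmodType K).

Record submodule_pred := SubmodulePred {
  subm_mem :> V -> bool;
  subm_closed : submod_closed subm_mem }.

HB.instance Definition _ (S : submodule_pred) :=
  GRing.isSubmodClosed.Build K V (subm_mem S) (subm_closed S).

(** Indexing the type by the predicate together with its closure proof lets the
    module structure be inferred from the type alone. *)
Record submodule (S : submodule_pred) :=
  Submodule { subm_val :> V; subm_valP : subm_mem S subm_val }.
Variable S : submodule_pred.
HB.instance Definition _ := [isSub of submodule S for @subm_val S].
HB.instance Definition _ := [Choice of submodule S by <:].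
HB.instance Definition _ := [SubChoice_isSubLmodule of submodule S by <:].

Lemma subm_valE (a : K) (u v : submodule S) :
  subm_val (a *: u + v) = a *: subm_val u + subm_val v.
Proof. by []. Qed.

Lemma subm_val_sum (T : Type) (s : seq T) (c : T -> K) (u : T -> submodule S) :
  subm_val (\sum_(i <- s) c i *: u i) = \sum_(i <- s) c i *: subm_val (u i).
Proof.
rewrite [LHS](raddf_sum (\val : submodule S -> V)).
by apply: eq_bigr => i _; exact: (linearZ_LR (\val : submodule S -> V)).
Qed.
End Submodule.

Definition finitely_supported (L : choiceType) (M : nmodType) (w : L -> M) :=
  exists F : {fset L}, forall l, l \notin F -> w l = 0.

Section DualBasis.
Variables (K : pzRingType) (P : lmodType K) (L : choiceType).

Definition dual_basis (e : L -> P) (phi : L -> {linear P -> K^o}) :=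
  (forall p, finitely_supported (phi^~ p)) /\
  (forall p, p = \sum_(l \in setT) (phi l p : K) *: e l).

Lemma coord_sumE (M : lmodType K) (c : L -> K^o) (m : L -> M) (F : {fset L}) :
    (forall l, l \notin F -> c l = 0) ->
  \sum_(l \in setT) (c l : K) *: m l = \sum_(l <- F) (c l : K) *: m l.
Proof. by move=> F0; apply: fsbigTE => l /F0 ->; rewrite scale0r. Qed.

(** Such sums are evaluated over any finite set containing the support; two
    vectors u and v are compared on the union of their supports. *)
Lemma coord_sum_linear (M : lmodType K) (phi : L -> {linear P -> K^o})
    (m : L -> M) : (forall p, finitely_supported (phi^~ p)) ->
  linear (fun p => \sum_(l \in setT) (phi l p : K) *: m l).
Proof.
move=> phi_fin a u v /=.
have [[F F0] [G G0]] := (phi_fin u, phi_fin v).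
have FG0 l : l \notin (F `|` G)%fset -> phi l u = 0 /\ phi l v = 0.
  by rewrite in_fsetU negb_or => /andP[/F0 ? /G0 ?].
rewrite !(@coord_sumE _ _ _ (F `|` G)%fset); do ?by move=> l /FG0 [].
  rewrite scaler_sumr -big_split; apply: eq_bigr => l _ /=.
  by rewrite linearP scalerDl scalerA.
by move=> l /FG0 [ul vl]; rewrite linearP /= ul vl scaler0 addr0.
Qed.

(** A map out of P is determined by the images of the e_l, and prescribing lifts
    of these images along the surjection g yields a lift of the map. *)
Lemma dual_basis_projective (e : L -> P) (phi : L -> {linear P -> K^o}) :
  dual_basis e phi -> projective P.
Proof.
move=> [phi_fin phiE] M N g f gsurj.
have [m mE] := choice (fun l => gsurj (f (e l))).
pose h p : M := \sum_(l \in setT) (phi l p : K) *: m l.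
pose hlin := GRing.isLinear.Build K P M _ h (coord_sum_linear m phi_fin).
exists (HB.pack h hlin : {linear P -> M}) => p.
have [F F0] := phi_fin p.
rewrite [in RHS](phiE p) /= /h !(coord_sumE _ F0) !linear_sum.
by apply: eq_bigr => l _; rewrite !linearZ /= mE.
Qed.

End DualBasis.

Section Free.
Variables (K : pzRingType) (L : choiceType).

Lemma finitely_supported_closed :
  submod_closed (fun w : L -> K^o => `[< finitely_supported w >]).
Proof.
split=> [|a u v /asboolP [F F0] /asboolP [G G0]]; apply/asboolP.
  by exists fset0.
exists (F `|` G)%fset => l; rewrite in_fsetU negb_or => /andP[/F0 ul /G0 vl].
by rewrite -[LHS]/(a *: u l + v l) ul vl scaler0 addr0.
Qed.

Definition free_module := submodule (SubmodulePred finitely_supported_closed).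

Definition coord (l : L) (w : free_module) : K^o := subm_val w l.

Lemma coord_linear l : linear (coord l).
Proof. by []. Qed.

HB.instance Definition _ l :=
  GRing.isLinear.Build K free_module K^o _ (coord l) (coord_linear l).

Lemma coord_fin w : finitely_supported (coord^~ w).
Proof. exact: (asboolP _ (subm_valP w)). Qed.

Lemma coord_delta l : exists w : free_module, forall l', coord l' w = (l' == l)%:R.
Proof.
have dl : `[< finitely_supported (fun l' : L => (l' == l)%:R : K^o) >].
  by apply/asboolP; exists [fset l]%fset => l'; rewrite in_fset1 => /negbTE ->.
by exists (@Submodule _ _ (SubmodulePred finitely_supported_closed) _ dl).
Qed.

End Free.

(** The identity of P lifts along the canonical surjection from the free module
    on the set P; the coordinates of the lift form a dual basis for the family of
    all elements of P. *)
Lemma projective_dual_basis (K : pzRingType) (P : lmodType K) :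
  projective P -> exists phi : P -> {linear P -> K^o}, dual_basis id phi.
Proof.
pose coords : P -> {linear free_module K P -> K^o} := fun p => coord p.
pose g w : P := \sum_(p \in setT) (coords p w : K) *: p.
pose glin := GRing.isLinear.Build K _ P _ g (coord_sum_linear id (@coord_fin K P)).
move=> /(_ _ _ (HB.pack g glin : {linear free_module K P -> P}) idfun) [p|h hK].
  have [w wE] := coord_delta K p; exists w; rewrite /= /g.
  have F0 p' : p' \notin [fset p]%fset -> coords p' w = 0.
    by rewrite in_fset1 /= wE => /negbTE ->.
  by rewrite (coord_sumE _ F0) big_seq_fset1 /= wE eqxx scale1r.
exists (fun p => coords p \o h); split=> p; last exact/esym/hK.
exact: coord_fin (h p).
Qed.

(** * Left ideals, and the trace ideal of a projective module *)

Section LeftIdeals.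
Variable R : pzRingType.
Implicit Types (A B J X : set R).

Lemma left_ideal_sum J (T : eqType) (s : seq T) (F : T -> R) :
  left_ideal J -> (forall i, i \in s -> J (F i)) -> J (\sum_(i <- s) F i).
Proof.
move=> [J0 JD _] JF; rewrite big_seq; elim/big_rec: _ => // i x /JF Ji Jx.
exact: JD.
Qed.

Lemma smallest_left_ideal X : left_ideal (smallest (@left_ideal _) X).
Proof.
split=> [A [[]]|x y Jx Jy A AX|a x Jx A AX]//.
- by case: AX.1 => _ + _; apply; [exact: Jx|exact: Jy].
- by case: AX.1 => _ _; apply; exact: Jx.
Qed.

Lemma smallest_left_idealP (B : {fset R}) x :
  smallest (@left_ideal _) [set` B] x ->
  exists c : R -> R, x = \sum_(b <- B) c b * b.
Proof.
apply: (@smallest_sub _ _ _ [set y | exists c, y = \sum_(b <- B) c b * b]).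
  split=> /= [|x' y' [c ->] [d ->]|a x' [c ->]].
  - by exists (fun=> 0); rewrite big1// => b _; rewrite mul0r.
  - exists (fun b => c b + d b); rewrite -big_split; apply: eq_bigr => b _.
    by rewrite mulrDl.
  - exists (fun b => a * c b); rewrite big_distrr; apply: eq_bigr => b _ /=.
    by rewrite mulrA.
move=> b /= bB; exists (fun b' => (b' == b)%:R).
rewrite (big_fsetD1 b)//= eqxx mul1r big_seq big1 ?addr0// => b'.
by rewrite in_fsetD1 => /andP[/negbTE-> _]; rewrite mul0r.
Qed.

Lemma ideal_mul_in A B a b : A a -> B b -> ideal_mul A B (a * b).
Proof.
by move=> Aa Bb; exists 1%N, (fun=> a), (fun=> b); split; rewrite ?big_ord1.
Qed.

Lemma ideal_mul_left_ideal A B : left_ideal A -> left_ideal (ideal_mul A B).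
Proof.
move=> [A0 AD AM]; split.
- by exists 0%N, (fun=> 0), (fun=> 0); split=> [||]; rewrite ?big_ord0//; case.
- move=> _ _ [n [a [b [Aa Bb ->]]]] [n' [a' [b' [Aa' Bb' ->]]]].
  pose glue (u : 'I_n -> R) u' (k : 'I_(n + n')) :=
    match fintype.split k with inl i => u i | inr i => u' i end.
  exists (n + n')%N, (glue a a'), (glue b b'); split=> [k|k|].
  + by rewrite /glue; case: fintype.split.
  + by rewrite /glue; case: fintype.split.
  rewrite big_split_ord /glue; congr (_ + _); apply: eq_bigr => i _.
    by rewrite (unsplitK (inl i)).
  by rewrite (unsplitK (inr i)).
- move=> r _ [n [a [b [Aa Bb ->]]]].
  exists n, (fun i => r * a i), b; split=> // [i|]; first exact: AM.
  by rewrite big_distrr; apply: eq_bigr => i _; rewrite /= mulrA.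
Qed.

Lemma ideal_mul_subr A B : left_ideal B -> ideal_mul A B `<=` B.
Proof.
move=> Bl _ [n [a [b [_ Bb ->]]]]; apply: left_ideal_sum => // i _.
by case: Bl => _ _; apply.
Qed.

End LeftIdeals.

Definition reproduced_by_chains (R : pzRingType) (I : set R) : Prop :=
  forall X : set R, finite_set X -> X `<=` I ->
    exists J1 J2 : set R,
      [/\ fg_left_ideal J1, fg_left_ideal J2, J1 `<=` J2, J2 `<=` I &
          X `<=` J1 /\ ideal_mul J2 J1 = J1].

Lemma trace_ideal_mem (R : pzRingType) (P : lmodType R^c)
  (f : {linear P -> R^c^o}) p : trace_ideal P (f p : R).
Proof. by exists 1%N, (fun=> f), (fun=> p); rewrite big_ord1. Qed.

(** Linear forms satisfy f(p) = sum of f(e_q) phi_q(p) for a dual basis e, phi; here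
    e is the family of all elements of P.  Taking f = phi_q shows that the
    coordinates of p are reproduced by the coordinates of the basis elements. *)
Lemma trace_ideal_chain (R : pzRingType) (I : set R) (P : lmodType R^c) :
  left_ideal I -> projective P -> I = trace_ideal P -> reproduced_by_chains I.
Proof.
move=> Il /projective_dual_basis[phi [phi_fin phiE]] IP X Xfin XI.
have [F F0] := choice phi_fin.
have linE (f : {linear P -> R^c^o}) p :
    f p = \sum_(q <- F p) (f q : R) * (phi q p : R) :> R.
  rewrite [in LHS](phiE p) (coord_sumE _ (F0 p)) linear_sum.
  by apply: eq_bigr => q _; rewrite linearZ.
have X_gen x : exists s : seq P, X x -> forall J, left_ideal J ->
    (forall (f : {linear P -> R^c^o}) p, p \in s -> J (f p : R)) -> J x.
  have [/XI|Xx] := pselect (X x); last by exists [::].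
  rewrite IP => -[n [f [p ->]]]; exists (codom p) => _ J Jl Jf.
  by apply: left_ideal_sum => // i _; apply: Jf; exact: codom_f.
have [ps psP] := choice X_gen.
have [Xs XE] := (finite_seqP X).1 Xfin.
pose gen := flatten [seq ps x | x <- Xs].
pose ind := flatten [seq enum_fset (F p) | p <- gen].
pose B1 := [seq (phi q p : R) | q <- ind, p <- gen].
pose B2 := [seq (phi r q : R) | r <- ind, q <- ind].
pose J1 := smallest (@left_ideal _) [set` B1].
pose J2 := smallest (@left_ideal _) ([set` B1] `|` [set` B2]).
have J1l : left_ideal J1 by exact: smallest_left_ideal.
have J2l : left_ideal J2 by exact: smallest_left_ideal.
have ind_supp p q : p \in gen -> q \in F p -> q \in ind.
  by move=> pg qF; apply/flattenP; exists (enum_fset (F p)) => //; apply: map_f.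
have genJ1 p q : p \in gen -> q \in F p -> J1 (phi q p : R).
  move=> pg qF; apply: sub_gen_smallest => /=.
  by apply/allpairsP; exists (q, p); rewrite /= (ind_supp p).
exists J1, J2; split.
- by exists [set` B1] => //; exact: finite_seq.
- exists ([set` B1] `|` [set` B2]) => //.
  by rewrite finite_setU; split; exact: finite_seq.
- by apply: smallest_sub => // x B1x; apply: sub_gen_smallest; left.
- rewrite IP in Il *; apply: smallest_sub => // x [] /= /allpairsP[] -[q p];
  by move=> [_ _ ->]; exact: trace_ideal_mem.
split=> [x Xx|].
  apply: psP => // f p pps; rewrite linE; apply: left_ideal_sum => // q qF.
  have [_ _] := J1l; apply; apply: genJ1 => //.
  by apply/flattenP; exists (ps x) => //; apply: map_f; rewrite XE in Xx.
apply/seteqP; split; first exact: ideal_mul_subr.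
apply: smallest_sub; first exact: ideal_mul_left_ideal.
move=> _ /= /allpairsP[] -[q p] /= [qi pg ->]; rewrite linE.
apply: left_ideal_sum => [|r rF]; first exact: ideal_mul_left_ideal.
apply: ideal_mul_in; last exact: genJ1.
apply: sub_gen_smallest; right => /=; apply/allpairsP; exists (q, r).
by rewrite /= qi (ind_supp p).
Qed.

(** * Matrices indexed by finite types *)

Section FiniteMatrices.
Variable R : pzRingType.

Definition dim_Minf (x : Minf R) : nat :=
  \max_(p <- finsupp x) (maxn p.1 p.2).+1.

Lemma dim_MinfP (x : Minf R) i j :
  (dim_Minf x <= i)%N || (dim_Minf x <= j)%N -> x (i, j) = 0.
Proof.
apply: contraTeq; rewrite -mem_finsupp => ij.
have le_dim : ((maxn i j).+1 <= dim_Minf x)%N.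
  pose size_at (p : nat * nat) := (maxn p.1 p.2).+1.
  exact: (@leq_bigmax_seq _ _ xpredT size_at (i, j)).
by rewrite negb_or -!ltnNge -gtn_max.
Qed.

(** Rows and columns are numbered by [enum_rank], so that tensor products of
    matrices can be indexed by pairs. *)
Section Indexed.
Variables (A B : finType).

Definition entry_of (f : A -> B -> R) (p : nat * nat) : R :=
  match insub p.1 : option 'I_#|A|, insub p.2 : option 'I_#|B| with
  | Some i, Some j => f (enum_val i) (enum_val j)
  | _, _ => 0
  end.

Definition Minf_of (f : A -> B -> R) : Minf R :=
  [fsfun p in [fset p in [seq (i, j) | i <- iota 0 #|A|, j <- iota 0 #|B|]]%fset =>
     entry_of f p].

Lemma Minf_ofE f p : Minf_of f p = entry_of f p.
Proof.
rewrite fsfunE; case: ifPn => // /negP pN; rewrite /entry_of.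
case: insubP => // i iA _; case: insubP => // j jB _.
case: pN; rewrite in_fset; apply/allpairsP.
by exists p; rewrite !mem_iota; split=> //; case: (p).
Qed.

Lemma Minf_of_rank f a b : Minf_of f (enum_rank a : nat, enum_rank b : nat) = f a b.
Proof. by rewrite Minf_ofE /entry_of /= !valK !enum_rankK. Qed.

Lemma Minf_of_out f i j :
  (#|A| <= i)%N || (#|B| <= j)%N -> Minf_of f (i, j) = 0.
Proof.
rewrite Minf_ofE /entry_of /=.
case/orP => le; case: insubP => // a; first by rewrite ltnNge le.
by case: insubP => // b; rewrite ltnNge le.
Qed.

Lemma Minf_of_in (I : set R) f :
  I 0 -> (forall a b, I (f a b)) -> Minf_in I (Minf_of f).
Proof.
move=> I0 If i j; rewrite Minf_ofE /entry_of.
by case: insub => // a; case: insub.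
Qed.

Lemma eq_Minf_of (x : Minf R) f :
  (forall a b, x (enum_rank a : nat, enum_rank b : nat) = f a b) ->
  (forall i j, (#|A| <= i)%N || (#|B| <= j)%N -> x (i, j) = 0) ->
  x = Minf_of f.
Proof.
move=> xf x0; apply/fsfunP => -[i j].
have [out|] := boolP ((#|A| <= i)%N || (#|B| <= j)%N).
  by rewrite x0 // Minf_of_out.
rewrite negb_or -!ltnNge => /andP[iA jB].
have -> : (i, j) = (enum_rank (enum_val (Ordinal iA)) : nat,
                    enum_rank (enum_val (Ordinal jB)) : nat).
  by rewrite !enum_valK.
by rewrite xf Minf_of_rank.
Qed.

End Indexed.

Lemma Minf_of_ord n (x : Minf R) : (dim_Minf x <= n)%N ->
  x = Minf_of (fun i j : 'I_n => x (i : nat, j : nat)).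
Proof.
move=> xn; apply: eq_Minf_of => [a b|i j]; first by rewrite !enum_rank_ord.
rewrite card_ord => /orP[] h; by apply: dim_MinfP; rewrite (leq_trans xn h) ?orbT.
Qed.

Lemma mul_Minf_of (A B C : finType) (f : A -> B -> R) (g : B -> C -> R) :
  mul_Minf (Minf_of f) (Minf_of g) = Minf_of (fun a c => \sum_b f a b * g b c).
Proof.
have sumE i k : mul_Minf (Minf_of f) (Minf_of g) (i, k) =
    \sum_(b : B) Minf_of f (i, enum_rank b : nat) * Minf_of g (enum_rank b : nat, k).
  rewrite (@mul_MinfE _ _ _ #|B|) => [|j jB]; last first.
    by rewrite Minf_of_out ?jB ?orbT.
  rewrite [LHS](reindex (@enum_rank B)) //.
  by apply: onW_bij; exact: enum_rank_bij.
apply: eq_Minf_of => [a c|i k ik]; rewrite sumE.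
  by apply: eq_bigr => b _; rewrite !Minf_of_rank.
rewrite big1 // => b _; case/orP: ik => [iA|kC].
  by rewrite Minf_of_out ?iA ?mul0r.
by rewrite [X in _ * X]Minf_of_out ?kC ?orbT ?mulr0.
Qed.

(** The column b of generators of J1 satisfies b = s b with s over I.  In order to
    recover all columns of x, b is replaced by its tensor product y with the
    identity matrix of size n, and s by its tensor product s1 with the same
    identity. *)
Lemma quasipure_of_chain (I : set R) :
  two_sided_ideal I -> reproduced_by_chains I -> quasipure I.
Proof.
move=> [Il IMr] chain x xI; have [I0 ID IM] := Il.
set n := dim_Minf x.
have [] := chain [set` [seq x (i, j) | i <- iota 0 n, j <- iota 0 n]].
- exact: finite_seq.
- by move=> _ /= /allpairsP[] -[i j] [_ _ ->]; exact: xI.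
move=> J1 [J2 [[B Bfin J1E] J2fg J12 J2I [xJ1 J21]]].
have [G GE] := finite_fsetP.1 Bfin; subst B.
have combJ1 r : J1 r -> exists c : G -> R, r = \sum_b c b * val b.
  rewrite J1E => /smallest_left_idealP[c ->]; exists (c \o val).
  by rewrite big_seq_fsetE.
have xP (q : 'I_n * 'I_n) : exists c : G -> R,
    x (q.1 : nat, q.2 : nat) = \sum_b c b * val b.
  apply/combJ1/xJ1 => /=; apply/allpairsP; exists (q.1 : nat, q.2 : nat).
  by rewrite /= !mem_iota !ltn_ord.
have [c cE] := choice xP.
have sP (b : G) : exists s : G -> R,
    (forall b', I (s b')) /\ val b = \sum_b' s b' * val b'.
  have: ideal_mul J2 J1 (val b).
    rewrite J21 J1E; apply: sub_gen_smallest; exact: (valP b).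
  move=> [m [u [v [uJ2 vJ1 ->]]]].
  have [w wE] := choice (fun i => combJ1 _ (vJ1 i)).
  exists (fun b' => \sum_i u i * w i b'); split=> [b'|].
    by apply: left_ideal_sum => // i _; apply/IMr/J2I.
  under [RHS]eq_bigr do rewrite big_distrl.
  rewrite exchange_big; apply: eq_bigr => i _; rewrite [in LHS]wE big_distrr.
  by apply: eq_bigr => b' _; rewrite /= mulrA.
have [s sE] := choice sP.
(* Rows of y are indexed by a generator and a column of x. *)
pose y (p : G * 'I_n) (k : 'I_n) := if p.2 == k then val p.1 else 0.
pose s1 (p q : G * 'I_n) := if p.2 == q.2 then s p.1 q.1 else 0.
have sum_y (u : G * 'I_n -> R) k : \sum_p u p * y p k = \sum_b u (b, k) * val b.
  transitivity (\sum_b \sum_j u (b, j) * y (b, j) k).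
    by rewrite pair_bigA; apply: eq_bigr => -[].
  apply: eq_bigr => b _; rewrite (bigD1 k) //= {1}/y eqxx big1 ?addr0 // => j.
  by move=> /negbTE jk; rewrite /y /= jk mulr0.
have GI (b : G) : I (val b).
  by apply/J2I/J12; rewrite J1E; apply: sub_gen_smallest; exact: (valP b).
exists (Minf_of s1), (Minf_of y); split.
- by apply: Minf_of_in => // p q; rewrite /s1; case: eqP => // _; case: (sE p.1).
- by apply: Minf_of_in => // p q; rewrite /y; case: eqP => // _; exact: GI.
- rewrite mul_Minf_of; congr Minf_of; apply/funext => -[b k]; apply/funext => k'.
  rewrite sum_y /s1 /y /=; case: eqP => _; first by rewrite -(sE b).2.
  by rewrite big1 // => b' _; rewrite mul0r.
exists (Minf_of (fun (i : 'I_n) (p : G * 'I_n) => c (i, p.2) p.1)).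
exists (Minf_of (fun i j : 'I_n => (i == j)%:R)).
rewrite !mul_Minf_of {1}(@Minf_of_ord n x) //; congr Minf_of.
apply/funext => i; apply/funext => k.
rewrite (bigD1 k) //= eqxx mulr1 [X in _ + X]big1 ?addr0; last first.
  by move=> j /negbTE ->; rewrite mulr0.
by rewrite sum_y (cE (i, k)).
Qed.

End FiniteMatrices.

(** * The tower of matrices attached to a quasipure ideal *)

Section Action.
Variable R : pzRingType.
Implicit Types (x y z : Minf R) (v : nat -> R^c^o).

(** Columns are arbitrary sequences: since y has finitely many nonzero entries, the
    product makes sense without any support condition on v, and it is linear for
    the right action of R. *)
Definition act y v : nat -> R^c^o :=
  fun i => \sum_(j < dim_Minf y) y (i, j : nat) * (v j : R) : R.

Lemma actE y v i n : (dim_Minf y <= n)%N ->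
  act y v i = \sum_(j < n) y (i, j : nat) * (v j : R) :> R.
Proof.
move=> yn; rewrite /act (big_ord_widen n (fun j => y (i, j) * (v j : R))) //.
rewrite [LHS]big_mkcond; apply: eq_bigr => j _; case: ltnP => // yj.
by rewrite dim_MinfP ?yj ?orbT ?mul0r.
Qed.

Lemma act_linear y : linear (act y).
Proof.
move=> a u v; apply/funext => i; rewrite /act.
have -> : forall f g : nat -> R^c^o, (a *: f + g) i = (f i : R) * a + g i by [].
rewrite big_distrl -big_split; apply: eq_bigr => j _ /=.
by rewrite -mulrA -mulrDr.
Qed.

HB.instance Definition _ y :=
  GRing.isLinear.Build R^c (nat -> R^c^o) (nat -> R^c^o) _ (act y) (act_linear y).

Lemma mul_Minf_act x y i k :
  mul_Minf x y (i, k) = act x (fun j => y (j, k)) i.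
Proof. by apply: mul_MinfE => j xj; rewrite dim_MinfP ?xj ?orbT. Qed.

Lemma act_mul x y v : act (mul_Minf x y) v = act x (act y v).
Proof.
apply/funext => i.
set n := maxn (dim_Minf (mul_Minf x y)) (maxn (dim_Minf x) (dim_Minf y)).
have := leqnn n; rewrite {1}/n !geq_max => /and3P[xyn xn yn].
rewrite (actE _ _ xyn) (actE _ _ xn).
under eq_bigr do rewrite mul_Minf_act (actE _ _ xn) big_distrl.
rewrite exchange_big; apply: eq_bigr => j _; rewrite (actE _ _ yn) big_distrr.
by apply: eq_bigr => k _; rewrite /= mulrA.
Qed.

Lemma mul_MinfA x y z : mul_Minf x (mul_Minf y z) = mul_Minf (mul_Minf x y) z.
Proof.
apply/fsfunP => -[i k]; rewrite !mul_Minf_act act_mul; congr act.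
by apply/funext => j; rewrite mul_Minf_act.
Qed.

Lemma act_in (I : set R) y v : two_sided_ideal I -> Minf_in I y ->
  forall i, I (act y v i).
Proof.
by move=> [Il IM] yI i; apply: left_ideal_sum => // j _; exact: IM (yI _ _).
Qed.

Lemma act_vec_in (I : set R) y v : left_ideal I -> (forall j, I (v j)) ->
  forall i, I (act y v i).
Proof.
move=> Il vI i; apply: left_ideal_sum => // j _; have [_ _] := Il; apply.
exact: vI.
Qed.

Lemma act_out y v i : (dim_Minf y <= i)%N -> act y v i = 0.
Proof. by move=> yi; apply: big1 => j _; rewrite dim_MinfP ?yi ?mul0r. Qed.

(** With state c_0 = x, quasipurity writes c_n = u_n A_n and provides the next
    state c_(n+1) with c_(n+1) A_n = A_n; then T_n = u_(n+1) works.  The matrix t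
    of the relation c_n = u_n y t is absorbed in A_n = y t. *)
Lemma quasipure_tower (I : set R) : two_sided_ideal I -> quasipure I ->
  exists A T : Minf R -> nat -> Minf R,
    [/\ forall x n, Minf_in I (A x n),
        forall x n, mul_Minf (T x n) (mul_Minf (A x n.+1) (A x n)) = A x n
      & forall x, Minf_in I x -> exists t, x = mul_Minf t (A x 0%N)].
Proof.
move=> I2 qI; have [Il _] := I2; have [I0 _ _] := Il.
have step x : exists r : Minf R * Minf R * Minf R,
    [/\ Minf_in I r.1.2, Minf_in I r.2, mul_Minf r.1.2 r.2 = r.2
      & Minf_in I x -> x = mul_Minf r.1.1 r.2].
  have [/qI[s [y [sI yI syE [u [t xE]]]]]|nxI] := pselect (Minf_in I x).
    exists (u, s, mul_Minf y t); split=> //=.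
    - by move=> i j; rewrite mul_Minf_act; exact: act_in.
    - by rewrite mul_MinfA syE.
    - by rewrite mul_MinfA.
  (* A matrix with an entry outside I is followed by zero matrices. *)
  pose z : Minf R := [fsfun for fun=> 0].
  have zI : Minf_in I z by move=> i j; rewrite fsfun0E.
  exists (z, z, z); split=> //; apply/fsfunP => -[i j].
  by rewrite mul_Minf_act fsfun0E; apply: big1 => k _; rewrite fsfun0E mul0r.
have [r rP] := choice step.
pose st x n := iter n (fun x => (r x).1.2) x.
have stI x n : Minf_in I (st x n.+1) by case: (rP (st x n)).
exists (fun x n => (r (st x n)).2), (fun x n => (r (st x n.+1)).1.1).
split=> [x n|x n|x xI]; first by case: (rP (st x n)).
  have [_ _ syE _] := rP (st x n).
  have [_ _ _ /(_ (stI x n)) uyE] := rP (st x n.+1).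
  by rewrite mul_MinfA -uyE.
by exists (r x).1.1; have [_ _ _ /(_ xI)] := rP x.
Qed.

End Action.

(** * The projective module of a tower *)

Section Tower.
Variables (R : pzRingType) (X : choiceType) (A T : X -> nat -> Minf R).

Definition thread := X -> nat -> nat -> R^c^o.

Definition compatible (w : thread) := forall x n, w x n = act (T x n) (w x n.+1).

(** Where the defect vanishes, w follows the transition matrices of the tower. *)
Definition defect (w : thread) (l : X * nat * nat) : R^c^o :=
  (w l.1.1 l.1.2 - if l.1.2 is n.+1 then act (A l.1.1 n.+1) (w l.1.1 n) else 0) l.2.

Lemma defect_linear l : linear (defect^~ l : thread -> R^c^o).
Proof.
move=> a u v; case: l => -[x [|n]] j; rewrite /defect /=.
  by rewrite !subr0.
have -> : (a *: u + v) x n.+1 = a *: u x n.+1 + v x n.+1 by [].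
have -> : (a *: u + v) x n = a *: u x n + v x n by [].
by rewrite linearP opprD addrACA -scalerBr.
Qed.

(** The direct sum, over x, of the direct limits of the towers A x: an element of
    the limit is represented by its images under the retractions T, which follow
    the tower eventually.  Finiteness of the total defect also forces w x to
    vanish for all but finitely many x. *)
Lemma tower_closed : submod_closed (fun w : thread =>
  `[< compatible w /\ finitely_supported (defect w) >]).
Proof.
split=> [|a u v /asboolP [uT [F F0]] /asboolP [vT [G G0]]]; apply/asboolP.
  split=> [x n|]; first by rewrite -[RHS]/(act _ 0) linear0.
  exists fset0 => -[[x [|n]] j] _; rewrite /defect /= ?subr0 //.
  by rewrite -[X in _ - act _ X]/(0 : nat -> R^c^o) linear0 subr0.
split=> [x n|].
  have -> : (a *: u + v) x n.+1 = a *: u x n.+1 + v x n.+1 by [].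
  by rewrite linearP /= -uT -vT.
exists (F `|` G)%fset => l; rewrite in_fsetU negb_or => /andP[/F0 ul /G0 vl].
by rewrite defect_linear ul vl scaler0 addr0.
Qed.

Definition tower_pred := SubmodulePred tower_closed.
Definition tower_module := submodule tower_pred.

Definition defect_coord l (p : tower_module) : R^c^o := defect (subm_val p) l.

Lemma defect_coord_linear l : linear (defect_coord l).
Proof. by move=> a u v; rewrite /defect_coord subm_valE; exact: defect_linear. Qed.

HB.instance Definition _ l :=
  GRing.isLinear.Build R^c tower_module R^c^o _ _ (defect_coord_linear l).

Lemma tower_compatible (p : tower_module) : compatible (subm_val p).
Proof. by case/asboolP: (subm_valP p). Qed.

Lemma tower_finite (p : tower_module) : finitely_supported (defect_coord^~ p).
Proof. by case/asboolP: (subm_valP p). Qed.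

(** A compatible thread is determined by its tails, as w_n = T_n w_(n+1). *)
Lemma compatible_eq (w w' : thread) N : compatible w -> compatible w' ->
  (forall x n, (N <= n)%N -> w x n = w' x n) -> w = w'.
Proof.
move=> wT w'T eqN; apply/funext => x; apply/funext => n.
have : (N <= n + N)%N by rewrite leq_addl.
elim: {2}N n => [|k IH] n; first by rewrite addn0; exact: eqN.
by rewrite addnS -addSn => /IH eqn; rewrite wT w'T eqn.
Qed.

Section Generators.
Hypothesis TAA : forall x n,
  mul_Minf (T x n) (mul_Minf (A x n.+1) (A x n)) = A x n.

Fixpoint push x m k (v : nat -> R^c^o) : nat -> R^c^o :=
  if k is k'.+1 then act (A x (m + k')) (push x m k' v) else v.

Fixpoint pull x n k (v : nat -> R^c^o) : nat -> R^c^o :=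
  if k is k'.+1 then act (T x n) (pull x n.+1 k' v) else v.

Lemma pullSr x n k v : pull x n k.+1 v = pull x n k (act (T x (n + k)) v).
Proof.
elim: k n => [|k IH] n /=; first by rewrite addn0.
by rewrite -[RHS]/(pull x n k.+1 _) [RHS]/= addnS -addSn -IH.
Qed.

(** The relation T_n A_(n+1) A_n = A_n only cancels the last step when two steps
    at least were made. *)
Lemma act_push x m k v :
  act (T x (m + k)) (push x m k.+2 v) = push x m k.+1 v.
Proof. by rewrite /= addnS -!act_mul -mul_MinfA TAA. Qed.

Lemma pull_push x m k j v :
  pull x (m + k) j (push x m (k + j).+1 v) = push x m k.+1 v.
Proof.
elim: j => [|j IH]; first by rewrite addn0.
by rewrite pullSr addnS -addnA act_push.
Qed.

(** The class in the limit of the column v placed at level m: it is pushed beyond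
    level n and then pulled back to index n.  Index n of a thread is the target of
    A_n, hence corresponds to level n + 1. *)
Definition generator_fun x m v : thread :=
  fun x' n => if x' == x then pull x n m (push x m n.+1 v) else 0.

Lemma generator_compatible x m v : compatible (generator_fun x m v).
Proof.
move=> x' n; rewrite /generator_fun; case: eqP => [->|_]; last by rewrite linear0.
by rewrite -[RHS]/(pull x n m.+1 _) pullSr [in T x _]addnC act_push.
Qed.

Lemma generator_stable x m k v :
  generator_fun x m v x (m + k) = push x m k.+1 v.
Proof.
by rewrite /generator_fun eqxx -[RHS](pull_push x m k m v) [(k + m)%N]addnC.
Qed.

(** The thread follows the tower from index m on, which leaves finitely many
    indices with a nonzero defect, and there the columns are images of finite
    matrices. *)
Lemma generator_finite x m v : finitely_supported (defect (generator_fun x m v)).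
Proof.
pose N := (\max_(n < m.+1) maxn (dim_Minf (T x n)) (dim_Minf (A x n)))%N.
exists [fset l in [seq (x, n, j) | n <- iota 0 m.+1, j <- iota 0 N]]%fset.
move=> [[x' n] j]; rewrite in_fset => /allpairsP lN; rewrite /defect /=.
have [x'x|/negbTE x'x] := eqVneq x' x; last first.
  by rewrite /generator_fun x'x; case: n lN => [|n] _; rewrite /= ?linear0 addr0.
subst x'; have [nm|mn] := leqP n m.
  have jN : (N <= j)%N.
    rewrite leqNgt; apply/negP => jN; apply: lN; exists (n, j).
    by rewrite !mem_iota.
  have : (maxn (dim_Minf (T x n)) (dim_Minf (A x n)) <= j)%N.
    apply: leq_trans jN.
    by rewrite (bigmax_sup (Ordinal (nm : n < m.+1)%N)).
  rewrite geq_max => /andP[Tj Aj].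
  rewrite generator_compatible -[LHS]/(_ j - _ j) act_out //.
  by case: n Aj {lN nm Tj} => [|n] Aj; rewrite ?act_out // subr0.
case: n mn {lN} => // n; rewrite ltnS => mn; rewrite -(subnKC mn) -addnS.
by rewrite !generator_stable /= addnS subrr.
Qed.

Definition generator x m v : tower_module :=
  @Submodule _ _ tower_pred (generator_fun x m v)
    (asboolT (conj (@generator_compatible x m v) (generator_finite x m v))).

Definition delta (j : nat) : nat -> R^c^o := fun i => (i == j)%:R.

(** The response of the recursion w_(n+1) = A_(n+1) w_n to a unit inserted at
    index l.1.2; it agrees with the generator at level l.1.2.+1 after that index,
    but is zero before it. *)
Definition impulse (l : X * nat * nat) x n : nat -> R^c^o :=
  if (x == l.1.1) && (l.1.2 <= n)%N
  then push x l.1.2.+1 (n - l.1.2) (delta l.2) else 0.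

(** A sequence is the superposition of the responses to its own defects, by
    induction on w_(n+1) = A_(n+1) w_n + defect.  The cast of the scalar to the
    converse ring makes the scaling a right multiplication. *)
Lemma thread_sum_impulse (w : thread) (F : {fset X * nat * nat}) :
    (forall l, l \notin F -> defect w l = 0) ->
  forall x n, w x n = \sum_(l <- F) (defect w l : R^c) *: impulse l x n.
Proof.
move=> F0 x.
have sum_delta n : (w x n - if n is m.+1 then act (A x m.+1) (w x m) else 0) =
    \sum_(l <- F) if (l.1.1 == x) && (l.1.2 == n) then
      (defect w l : R^c) *: delta l.2 else 0.
  apply/funext => j; rewrite fct_sumE -[LHS]/(defect w (x, n, j)).
  have [lF|lF] := boolP ((x, n, j) \in F).
    rewrite (big_fsetD1 (x, n, j)) //= !eqxx /= big_seq big1 => [|l]; last first.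
      rewrite in_fsetD1 => /andP[ln _]; case: ifP => // /andP[/eqP l1 /eqP l2].
      rewrite -[LHS]/(_ *: _) /delta; case: eqP => [jl|_]; last exact: scaler0.
      by case/eqP: ln; case: l l1 l2 jl => -[? ?] ? /= -> -> ->.
    rewrite addr0 -[RHS]/(_ *: _) /delta eqxx.
    exact/esym/(mul1r (defect w (x, n, j) : R)).
  rewrite F0 // big_seq big1 // => l lF'.
  case: ifP => // /andP[/eqP l1 /eqP l2]; rewrite -[LHS]/(_ *: _) /delta.
  case: eqP => [jl|_]; last exact: scaler0.
  by case/negP: lF; case: l l1 l2 jl lF' => -[? ?] ? /= -> -> ->.
elim=> [|n IH].
  rewrite -[LHS]subr0 (sum_delta 0%N); apply: eq_bigr => l _.
  rewrite /impulse eq_sym leqn0; case: andP => [[_ /eqP ->]|_] //.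
  by rewrite scaler0.
rewrite -[LHS](subrK (act (A x n.+1) (w x n))) (sum_delta n.+1) {1}IH.
rewrite linear_sum -big_split; apply: eq_bigr => l _ /=; rewrite linearZ /=.
rewrite /impulse eq_sym; case: eqP => [_|_] /=; last by rewrite linear0 scaler0 addr0.
case: (ltngtP l.1.2 n.+1) => [ln|ln|->].
- by rewrite -ltnS ln add0r subSn // /= addSn subnKC.
- by rewrite leqNgt (ltnW ln) /= linear0 scaler0 addr0.
- by rewrite ltnn subnn linear0 scaler0 addr0.
Qed.

(** Beyond all indices of nonzero defect of p, impulses and generators coincide;
    two compatible threads that agree there are equal. *)
Lemma tower_dual_basis :
  dual_basis (fun l => generator l.1.1 l.1.2.+1 (delta l.2))
             (fun l => defect_coord l).
Proof.
split=> [|p]; first exact: tower_finite.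
have [F F0] := tower_finite p.
rewrite (coord_sumE _ F0); apply: val_inj => /=.
pose N := (\max_(l <- F) l.1.2.+1)%N.
apply: (@compatible_eq _ _ N); [exact: tower_compatible..|] => x n Nn.
rewrite (thread_sum_impulse F0) subm_val_sum !fct_sumE.
apply/funext => j.
rewrite big_seq [RHS]big_seq; apply: eq_bigr => l lF.
have ln : (l.1.2 < n)%N.
  by apply: leq_trans Nn; exact: (@leq_bigmax_seq _ _ xpredT (fun l => l.1.2.+1) l).
rewrite -[LHS]/(_ *: (impulse l x n j)) -[RHS]/(_ *: (generator_fun _ _ _ x n j)).
congr (_ *: _).
rewrite /impulse (ltnW ln) andbT; case: eqP => [->|/eqP/negbTE xl].
  by rewrite -(subnKC ln) generator_stable subnKC // -subSn.
by rewrite /generator_fun xl.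
Qed.

Lemma tower_projective : projective tower_module.
Proof. exact: dual_basis_projective tower_dual_basis. Qed.

End Generators.

(** Far enough, w_n = A_n w_(n-1) has entries in I, and left multiplication by the
    T_n carries this down to every index. *)
Lemma tower_entry_in (I : set R) (p : tower_module) : two_sided_ideal I ->
  (forall x n, Minf_in I (A x n)) -> forall x n j, I (subm_val p x n j).
Proof.
move=> I2 AI x n; have [Il _] := I2.
have [F F0] := tower_finite p.
pose N := (\max_(l <- F) l.1.2.+1)%N.
have : (N < n + N.+1)%N by rewrite leq_addl.
elim: {2}N.+1 n => [|k IH] n.
  case: n => // n; rewrite addn0 => Nn j.
  have /F0 : (x, n.+1, j) \notin F.
    apply/negP => lF.
    have := @leq_bigmax_seq _ _ xpredT (fun l => l.1.2.+1) _ lF isT.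
    by rewrite /= -/N leqNgt (leqW Nn).
  rewrite -[defect_coord _ _]/(_ - _) => /eqP; rewrite subr_eq0 => /eqP ->.
  exact: act_in.
rewrite addnS -addSn => /IH wI j.
by rewrite (tower_compatible p); exact: act_vec_in.
Qed.

Lemma tower_trace_sub (I : set R) : two_sided_ideal I ->
    (forall x n, mul_Minf (T x n) (mul_Minf (A x n.+1) (A x n)) = A x n) ->
    (forall x n, Minf_in I (A x n)) ->
  trace_ideal tower_module `<=` I.
Proof.
move=> I2 TAA AI _ [n [f [p ->]]]; have [Il _] := I2; have [_ ID IM] := Il.
apply: (@left_ideal_sum R) => // i _.
have [_ pE] := tower_dual_basis TAA; have [F F0] := tower_finite (p i).
rewrite [p i]pE (coord_sumE _ F0) linear_sum.
apply: (@left_ideal_sum R) => // -[[x m] j] _; rewrite linearZ; apply: (IM).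
have IN r : I r -> I (- r) by move=> Ir; rewrite -mulN1r; exact: IM.
have wI := tower_entry_in (p i) I2 AI.
rewrite -[defect_coord _ _]/(_ - _).
case: m => [|m]; first by rewrite subr0; exact: wI.
by apply: ID; [exact: wI|apply: IN; exact: act_in].
Qed.

(** Index 0 of the generator at level 0 given by the k-th unit column is the k-th
    column of A_0, and taking the left multiple of an entry by t (i, j) is a
    linear form. *)
Lemma sub_tower_trace (x : X) (t : Minf R) (i k : nat) :
    (forall x n, mul_Minf (T x n) (mul_Minf (A x n.+1) (A x n)) = A x n) ->
  trace_ideal tower_module (mul_Minf t (A x 0%N) (i, k)).
Proof.
move=> TAA.
pose f (j : nat) (p : tower_module) : R^c^o :=
  (t (i, j) : R) * (subm_val p x 0%N j : R) : R.
have f_linear j : linear (f j).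
  move=> a u v; rewrite /f subm_valE.
  rewrite -[LHS]/((t (i, j) : R) *
    ((subm_val u x 0%N j : R) * a + (subm_val v x 0%N j : R))).
  by rewrite mulrDr mulrA.
pose fl j := GRing.isLinear.Build R^c tower_module R^c^o _ _ (f_linear j).
exists (dim_Minf t).
exists (fun j : 'I__ => HB.pack (f j) (fl j) : {linear tower_module -> R^c^o}).
exists (fun=> generator TAA x 0 (delta k)).
rewrite mul_Minf_act; apply: eq_bigr => j _.
rewrite -[RHS]/(t (i, j : nat) * generator_fun x 0 (delta k) x 0%N j).
congr (_ * _).
rewrite /generator_fun eqxx /= addn0 (actE _ _ (leq_maxl _ k.+1)).
have kn : (k < maxn (dim_Minf (A x 0%N)) k.+1)%N by rewrite leq_max leqnn orbT.
rewrite (bigD1 (Ordinal kn)) //= big1 => [|j' /negbTE j'k]; last first.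
  by rewrite /delta -val_eqE /= in j'k *; rewrite j'k mulr0.
by rewrite /delta eqxx mulr1 addr0.
Qed.

End Tower.

Lemma quasipure_trace (R : pzRingType) (I : set R) :
  two_sided_ideal I -> quasipure I ->
  exists P : lmodType R^c, projective P /\ I = trace_ideal P.
Proof.
move=> I2 qI; have [A [T [AI TAA genI]]] := quasipure_tower I2 qI.
exists (tower_module A T); split; first exact: tower_projective TAA.
apply/seteqP; split; last exact: tower_trace_sub.
move=> r Ir; pose x := Minf_of (fun _ _ : 'I_1 => r).
have xI : Minf_in I x by apply: Minf_of_in => //; case: I2 => -[].
have [t xE] := genI x xI.
have <- : x (0, 0)%N = r.
  by have := Minf_of_rank (fun _ _ : 'I_1 => r) ord0 ord0; rewrite enum_rank_ord.
by rewrite xE; exact: sub_tower_trace.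
Qed.

Theorem lemma4p5 (R : pzRingType) (I : set R) (hI : two_sided_ideal I) :
  (quasipure I <->
   (forall X : set R, finite_set X -> X `<=` I ->
     exists J1 J2 : set R,
       [/\ fg_left_ideal J1, fg_left_ideal J2, J1 `<=` J2, J2 `<=` I &
          X `<=` J1 /\ ideal_mul J2 J1 = J1])) /\
  (quasipure I <->
   exists P : lmodType R^c, projective P /\ I = trace_ideal P).
Proof.
rewrite -/(reproduced_by_chains I).
have trace_of_quasipure := quasipure_trace hI.
have chain_of_trace :
    (exists P : lmodType R^c, projective P /\ I = trace_ideal P) ->
    reproduced_by_chains I.
  by move=> [P [Pproj IP]]; exact: trace_ideal_chain hI.1 Pproj IP.
have quasipure_of_chains := quasipure_of_chain hI.
by split; split=> [/trace_of_quasipure|] //; move=> /chain_of_trace.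
Qed.
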